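(* Let $\mathscr{A}=\{a_0<a_1<\cdots\}\subseteq\mathbb{N}$ be a sequence. The following are equivalent: (i) $A$ is $O$-regularly varying and has positive increase; (ii) $\displaystyle\int_1^x\frac{A(t)}{t}\,dt=\Theta(A(x))$; (iii) both $A(2x)=O(A(x))$ and $a_{2n}=O(a_n)$; (iv) $\displaystyle\int_1^x\frac{s_{\mathscr{A},h}(t)}{t}\,dt=\Theta(s_{\mathscr{A},h}(x))$ for all or at least some integer $h\geq 1$ (that is, if this holds for at least one $h\ge 1$ then it holds for all $h\geq 1$, and both versions are equivalent to the other conditions).
   Context: $\mathbb{N}$ includes $0$. A sequence is an infinite subset of $\mathbb{N}$, with elements $a_0<a_1<\cdots$ and counting function $A(x)=|\mathscr{A}\cap[0,x]|$. $s_{\mathscr{A},h}(x)$ is the number of ordered $h$-tuples $(k_1,\dots,k_h)\in\mathscr{A}^h$ with $k_1+\cdots+k_h\leq x$. Asymptotic symbols are as $x,n\to+\infty$, and $f\asymp g$ (equivalently $f=\Theta(g)$) means $f=O(g)$ and $g=O(f)$. A positive real function $f$ on some $[x_0,+\infty)$ ($x_0$ may be taken arbitrarily large) is $O$-regularly varying if $f(\lambda x)\asymp f(x)$ for every $\lambda>0$. It is almost increasing if there is $m>0$ with $f(y)\geq m f(x)$ for all $y\geq x\geq x_0$. The lower Matuszewska index is $\mathcal{M}_*(f)=\sup\{\gamma\in\mathbb{R}: x^{-\gamma}f(x)\text{ is almost increasing}\}$, and $f$ has positive increase if $\mathcal{M}_*(f)>0$. *)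

(* Defs.v *)
From HB Require Import structures.
From mathcomp Require Import all_boot all_order all_algebra finmap.
From mathcomp Require Import all_classical all_reals all_analysis.

Set Implicit Arguments.
Unset Strict Implicit.
Unset Printing Implicit Defensive.

Import Order.TTheory GRing.Theory Num.Theory.
Import numFieldNormedType.Exports.

Local Open Scope classical_set_scope.
Local Open Scope ring_scope.

(* [a] lists the elements of the infinite set [A] as a_0 < a_1 < ... ; for a
   given [A] there is exactly one such [a]. *)
Definition is_increasing_enumeration (A : set nat) (a : nat -> nat) : Prop :=
  {homo a : m n / (m < n)%N} /\ range a = A.

(* [fset_set X] is only meaningful for finite [X] (it is empty otherwise); both
   sets counted below are finite. *)
Definition counting_function (R : realType) (A : set nat) (x : R) : R :=
  #|` fset_set [set k : nat | A k /\ k%:R <= x] |%:R.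

Definition representation_sum (R : realType) (A : set nat) (h : nat) (x : R)
    : R :=
  #|` fset_set [set k : h.-tuple nat |
        (forall i, A (tnth k i)) /\ (\sum_(i < h) tnth k i)%N%:R <= x] |%:R.

Definition log_integral (R : realType) (f : R -> R) (x : R) : R :=
  \int[lebesgue_measure]_(t in `[1, x]) (f t / t).

Canonical pinfty_filter_on (R : numFieldType) : filter_on R :=
  FilterType (pinfty_nbhs R) (@proper_pinfty_nbhs R).

(* A function which the mathematics defines only on some [x0, +oo) is a total
   function here, constrained only near +oo: x0 is not part of the data. *)
Definition O_regularly_varying (R : realType) (f : R -> R) : Prop :=
  (\forall x \near +oo, 0 < f x) /\
  forall lambda : R, 0 < lambda ->
    ((fun x => f (lambda * x)) : R -> R^o) =Theta_+oo (f : R -> R^o).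

Definition almost_increasing (R : realType) (f : R -> R) : Prop :=
  exists x0 m : R, 0 < m /\
    forall x y : R, x0 <= x -> x <= y -> m * f x <= f y.

Definition lower_matuszewska_index (R : realType) (f : R -> R) : \bar R :=
  ereal_sup [set gamma%:E | gamma in
    [set gamma : R | almost_increasing (fun x => x `^ (- gamma) * f x)]].

Definition positive_increase (R : realType) (f : R -> R) : Prop :=
  (0 < lower_matuszewska_index f)%E.

(* Main.v *)
Require Import Defs.
From HB Require Import structures.
From mathcomp Require Import all_boot all_order all_algebra finmap.
From mathcomp Require Import all_classical all_reals all_analysis.
From mathcomp Require Import measurable_realfun zify ring lra.

(* For a nondecreasing, eventually positive [f], both "f is O-regularly varying
   with positive increase" and "the logarithmic integral of f is Theta(f)"
   amount to two dilation inequalities: [f (2 x) = O (f x)] (doubling) and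
   [2 f x <= f (l x)] for some [l > 1] and all large [x] (expanding).
   For the counting function [cA], expanding is the condition
   [a_(2n) = O(a_n)], because [n < cA x] iff [a_n <= x].  Finally
   [cA (x / h) ^ h <= s_h x <= cA x ^ h], and both inequalities pass between
   [cA] and [s_h] through such a sandwich. *)

Set Implicit Arguments.
Unset Strict Implicit.
Unset Printing Implicit Defensive.

Import Order.TTheory GRing.Theory Num.Theory.
Import numFieldNormedType.Exports.

Local Open Scope classical_set_scope.
Local Open Scope ring_scope.

(** * Asymptotic relations at infinity, as inequalities between nonnegative functions *)

Section asymptotics.
Context {R : realType}.
Implicit Types f g : R -> R.

Lemma near_pinftyM (P : R -> Prop) (l : R) : 0 < l ->
  (\forall x \near +oo, P x) -> \forall x \near +oo, P (l * x).
Proof.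
move=> l0 [M [_ PM]]; exists (M / l); split; first exact: num_real.
by move=> x; rewrite ltr_pdivrMr// mulrC => /PM.
Qed.

Lemma near_pinfty_ge_ex (P : R -> Prop) (m : R) :
  (\forall x \near +oo, P x) -> exists2 M, m <= M & forall x, M <= x -> P x.
Proof.
move=> [M [_ PM]]; exists (Num.max m (M + 1)); first by rewrite le_max lexx.
by move=> x; rewrite ge_max => /andP[_ Mx]; apply: PM; lra.
Qed.

Lemma eqO_ge0P (T : Type) (F : filter_on T) (f g : T -> R^o) :
  (forall x, 0 <= f x) -> (forall x, 0 <= g x) ->
  f =O_F g <-> exists2 C : R, 0 < C & \forall x \near F, f x <= C * g x.
Proof.
move=> f0 g0; rewrite eqO_exP; split=> -[C C0 H]; exists C => //.
  by apply: filterS H => x; rewrite !ger0_norm.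
by apply: filterS H => x; rewrite !ger0_norm.
Qed.

Lemma eqTheta_ge0P (f g : R -> R^o) :
  (forall x, 0 <= f x) -> (forall x, 0 <= g x) ->
  f =Theta_+oo g <-> exists2 C : R, 0 < C &
    \forall x \near +oo, f x <= C * g x /\ g x <= C * f x.
Proof.
move=> f0 g0; rewrite eqThetaE bigThetaE eqOmegaO !eqO_ge0P//; split.
  move=> [[C C0 fC] [D D0 gD]]; exists (C + D); first exact: addr_gt0.
  near=> x; split.
    have : f x <= C * g x by near: x.
    by move=> /le_trans; apply; rewrite ler_wpM2r// lerDl ltW.
  have : g x <= D * f x by near: x.
  by move=> /le_trans; apply; rewrite ler_wpM2r// lerDr ltW.
by move=> [C C0 H]; split; exists C => //; apply: filterS H => x [].
Unshelve. all: by end_near. Qed.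

End asymptotics.

(** * Integrability and increments of the logarithmic integral *)

Section logarithmic_integral.
Context {R : realType}.
Variable f : R -> R.
Hypotheses (f_ge0 : forall x, 0 <= f x) (f_ndecr : {homo f : x y / x <= y}).

Local Notation mu := (@lebesgue_measure R).

Lemma log_integral_ge0 x : 0 <= log_integral f x.
Proof.
apply: Rintegral_ge0 => t /=; rewrite in_itv /= => /andP[t1 _].
by rewrite divr_ge0// (le_trans _ t1).
Qed.

(** A monotone function is measurable, and on an interval bounded away from 0 the quotient [f t / t]
    is at most [f y / x]. *)
Lemma integrable_div_id (x y : R) : 0 < x ->
  mu.-integrable `[x, y] (EFin \o (fun t => f t / t)).
Proof.
move=> x0; apply: measurable_bounded_integrable => //=.
- by rewrite lebesgue_measure_itv; case: ifP => _; rewrite /= ?ltry// -EFinB ltry.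
- apply: measurable_funM; first exact: nondecreasing_measurable.
  apply: (eq_measurable_fun (fun t : R => t `^ (-1))).
    move=> t; rewrite inE /= in_itv /= => /andP[xt _].
    by rewrite powR_inv1// (le_trans (ltW x0)).
  exact: measurable_funTS.
- exists (f y / x); split; first exact: num_real.
  move=> M yM t /=; rewrite in_itv /= => /andP[xt ty].
  have t0 : 0 < t by exact: lt_le_trans xt.
  rewrite ger0_norm ?divr_ge0 ?(ltW t0)//; apply: le_trans (ltW yM).
  by rewrite ler_pM ?invr_ge0 ?(ltW t0) ?f_ndecr// lef_pV2.
Qed.

(** For [t] in []x, y]] monotonicity gives [f x / y <= f t / t <= f y / x]; the two bounds are the
    integrals of these constants. *)
Lemma log_integral_bounds (x y : R) : 1 <= x -> x <= y ->
  (y - x) / y * f x <= log_integral f y - log_integral f x <= (y - x) / x * f y.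
Proof.
move=> x1 xy; have x0 : 0 < x by exact: lt_le_trans x1.
have y0 : 0 < y by exact: lt_le_trans xy.
have int1 : mu.-integrable `[1, y] (EFin \o (fun t => f t / t)).
  exact: integrable_div_id.
have intx : mu.-integrable `]x, y] (EFin \o (fun t => f t / t)).
  apply: (integrableS _ _ _ int1) => //.
  by move=> t; rewrite /= !in_itv /= => /andP[xt ->]; rewrite (le_trans x1 (ltW xt)).
have mu_xy : fine (mu `]x, y]) = y - x.
  rewrite lebesgue_measure_itv /= lte_fin; case: ltrP => //= yx.
  by apply/eqP; rewrite eq_sym subr_eq0 eq_le xy yx.
have int_cst (c : R) : mu.-integrable `]x, y] (EFin \o (fun=> c)).
  apply: measurable_bounded_integrable => //=.
    by rewrite lebesgue_measure_itv; case: ifP => _; rewrite /= ?ltry// -EFinB ltry.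
  by exists `|c|; split=> [|M /ltW cM t _ //]; exact: num_real.
rewrite /log_integral Rintegral_itvB ?bnd_simp//.
have -> : (y - x) / y * f x = \int[mu]_(t in `]x, y]) (f x / y).
  by rewrite Rintegral_cst// mu_xy; ring.
have -> : (y - x) / x * f y = \int[mu]_(t in `]x, y]) (f y / x).
  by rewrite Rintegral_cst// mu_xy; ring.
apply/andP; split; apply: le_Rintegral => // t /=; rewrite in_itv /= => /andP[xt ty].
  have t0 : 0 < t by exact: lt_trans xt.
  by rewrite ler_pM ?invr_ge0 ?(ltW y0) ?f_ndecr ?(ltW xt)// lef_pV2.
have t0 : 0 < t by exact: lt_trans xt.
by rewrite ler_pM ?invr_ge0 ?(ltW t0) ?f_ndecr// lef_pV2// ltW.
Qed.

End logarithmic_integral.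

(** * Dilation inequalities for nondecreasing functions *)

Lemma expr_ge_ex {R : realType} (l m : R) : 1 < l -> exists n, m <= l ^+ n.
Proof.
(* Bernoulli's inequality: the powers of [l] dominate a line of positive slope [l - 1], which
   eventually passes [m]. *)
move=> l1; have bern n : 1 + n%:R * (l - 1) <= l ^+ n.
  elim: n => [|n IH]; first by rewrite mul0r addr0.
  rewrite exprS; apply: (@le_trans _ _ (l * (1 + n%:R * (l - 1)))).
    by rewrite -natr1; have := mulr_ge0 (ler0n R n) (sqr_ge0 (l - 1)); rewrite expr2; lra.
  by rewrite ler_wpM2l//; lra.
exists (Num.trunc (m / (l - 1))).+1; apply: le_trans (bern _).
rewrite -lerBlDl; apply: le_trans (_ : m <= _); first by lra.
by rewrite -ler_pdivrMr ?subr_gt0// ltW// truncnS_gt.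
Qed.

Definition doubling {R : realType} (f : R -> R) :=
  exists2 C, 0 < C & \forall x \near +oo, f (2 * x) <= C * f x.

Definition expanding {R : realType} (f : R -> R) :=
  exists2 l, 1 < l & \forall x \near +oo, 2 * f x <= f (l * x).

Section dilations.
Context {R : realType}.
Variable f : R -> R.
Hypotheses (f_ge0 : forall x, 0 <= f x) (f_ndecr : {homo f : x y / x <= y}).

(** Iterating [n] times multiplies the constants to [C ^+ n]; once [l ^+ n] exceeds [m],
    monotonicity replaces it by [m]. Thus a bound for a single dilation, however close to 1,
    controls all of them. *)
Lemma dilation_le_iter (l C m : R) : 1 < l -> 0 < C ->
  (\forall x \near +oo, f (l * x) <= C * f x) ->
  exists2 D, 0 < D & \forall x \near +oo, f (m * x) <= D * f x.
Proof.
move=> l1 C0 H; have l0 : 0 < l by exact: lt_trans l1.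
have iterH n : \forall x \near +oo, f (l ^+ n * x) <= C ^+ n * f x.
  elim: n => [|n IH]; first by near=> x; rewrite !expr0 !mul1r.
  have Hn := near_pinftyM (exprn_gt0 n l0) H.
  near=> x; rewrite 2!exprS -2!mulrA.
  have : f (l * (l ^+ n * x)) <= C * f (l ^+ n * x) by near: x.
  by move=> /le_trans; apply; rewrite ler_pM2l//; near: x.
have [n mn] := expr_ge_ex m l1; exists (C ^+ n); first exact: exprn_gt0.
near=> x; apply: (@le_trans _ _ (f (l ^+ n * x))); last by near: x.
by apply: f_ndecr; rewrite ler_wpM2r//; near: x; exact: (nbhs_pinfty_ge (num_real _)).
Unshelve. all: by end_near. Qed.

Lemma doubling_dilation (m : R) : doubling f ->
  exists2 C, 0 < C & \forall x \near +oo, f (m * x) <= C * f x.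
Proof. by move=> [C C0]; apply: dilation_le_iter => //; rewrite ltr1n. Qed.

Lemma expanding_iter (n : nat) : expanding f ->
  exists2 l, 1 < l & \forall x \near +oo, 2 ^+ n * f x <= f (l * x).
Proof.
move=> [l l1 H]; have l0 : 0 < l by exact: lt_trans l1.
(* The exponent [n.+1] instead of [n] keeps the factor above 1 when [n = 0]. *)
exists (l ^+ n.+1); first by rewrite exprn_egt1.
elim: n => [|n IH].
  near=> x; rewrite expr0 mul1r; apply: f_ndecr.
  by rewrite expr1 ler_peMl// ?ltW//; near: x; exact: (nbhs_pinfty_gt (num_real _)).
have Hn := near_pinftyM (exprn_gt0 n.+1 l0) H.
near=> x; rewrite exprS [l ^+ _]exprS -2!mulrA.
apply: (@le_trans _ _ (2 * f (l ^+ n.+1 * x))); first by rewrite ler_pM2l//; near: x.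
by near: x.
Unshelve. all: by end_near. Qed.

Lemma log_integral_Theta_growth :
  (log_integral f : R -> R^o) =Theta_+oo (f : R -> R^o) ->
  doubling f /\ expanding f.
Proof.
move/eqTheta_ge0P => /(_ (log_integral_ge0 f_ge0) f_ge0)[C C0].
move=> /(near_pinfty_ge_ex 1)[M M1 H]; split.
  (* The factor [1 + 1/(2C)] is so close to 1 that the integral between [x]
     and [y] is at most [f y / (2C)], which can be absorbed in [f y <= C I y]. *)
  have C2 : 0 < (2 * C)^-1 by rewrite invr_gt0 mulr_gt0.
  apply: (@dilation_le_iter (1 + (2 * C)^-1) (2 * C ^+ 2)).
  - by rewrite ltrDl.
  - by rewrite mulr_gt0// exprn_gt0.
  - exists M; split; first exact: num_real.
    move=> x /ltW Mx; have x1 : 1 <= x by exact: le_trans Mx.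
    set y := _ * x; have y_x : y - x = (2 * C)^-1 * x by rewrite /y; ring.
    have xy : x <= y by rewrite -subr_ge0 y_x mulr_ge0// ltW// (lt_le_trans _ x1).
    have [IfC _] := H x Mx; have [_ fIC] := H y (le_trans Mx xy).
    have /andP[_] := log_integral_bounds f_ge0 f_ndecr x1 xy.
    rewrite y_x mulfK; last by rewrite gt_eqF// (lt_le_trans _ x1).
    rewrite -(ler_pM2l C0) mulrBr.
    have -> : C * ((2 * C)^-1 * f y) = f y / 2 by field; rewrite gt_eqF.
    by rewrite -(ler_pM2l C0) in IfC; lra.
(* Each of the [n] dyadic intervals from [x] to [2 ^+ n * x] contributes at least half the value of
   [f] at its left end, hence at least [f x / 2]. *)
have I_ge n (x : R) : 1 <= x -> n%:R * (f x / 2) <= log_integral f (2 ^+ n * x).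
  move=> x1; elim: n => [|n IH]; first by rewrite mul0r log_integral_ge0.
  have z1 : 1 <= 2 ^+ n * x by rewrite mulr_ege1// exprn_ege1// ler1n.
  have xz : x <= 2 ^+ n * x by rewrite ler_peMl ?(le_trans _ x1)// exprn_ege1// ler1n.
  rewrite exprS -mulrA; set z := _ * x in IH z1 xz *.
  have z0 : 0 < z by exact: lt_le_trans z1.
  have zz : z <= 2 * z by lra.
  have /andP[+ _] := log_integral_bounds f_ge0 f_ndecr z1 zz.
  have -> : (2 * z - z) / (2 * z) = 2^-1 by field; rewrite gt_eqF.
  by have := f_ndecr xz; rewrite -[n.+1%:R]natr1; lra.
(* With [n > 4 * C] the integral up to [2 ^+ n * x] is at least [2 * C * f x], while it is at most
   [C * f (2 ^+ n * x)]. *)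
pose n := (Num.trunc (4 * C)).+1; exists (2 ^+ n).
  by rewrite exprn_egt1// ltr1n.
exists M; split; first exact: num_real.
move=> x /ltW Mx; have x1 : 1 <= x by exact: le_trans Mx.
have xz : x <= 2 ^+ n * x by rewrite ler_peMl ?(le_trans _ x1)// exprn_ege1// ler1n.
have [IfC _] := H _ (le_trans Mx xz).
rewrite -(ler_pM2l C0); apply: le_trans IfC; apply: le_trans (I_ge n x x1).
have : 4 * C <= n%:R by rewrite ltW// truncnS_gt.
by have := f_ge0 x; nra.
Qed.

Hypothesis f_gt0 : \forall x \near +oo, 0 < f x.

Lemma growth_log_integral_Theta : doubling f -> expanding f ->
  (log_integral f : R -> R^o) =Theta_+oo (f : R -> R^o).
Proof.
have lI0 := log_integral_ge0 f_ge0.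
have bnd := log_integral_bounds f_ge0 f_ndecr.
move=> [C C0 fC] [l l1 fl]; apply/(eqTheta_ge0P lI0 f_ge0).
have l0 : 0 < l by exact: lt_trans l1.
have [M M1 {fl} H] : exists2 M, 1 <= M & forall x, M <= x -> 0 < f x /\ 2 * f x <= f (l * x).
  by apply: near_pinfty_ge_ex; near=> x; split; near: x.
have M0 : 0 < M by exact: lt_le_trans M1.
have [fM0 _] := H M (lexx _).
(* [log_integral f x <= log_integral f (x / l) + (l - 1) * f x] while
   [f (x / l) <= f x / 2], so a bound with constant [K >= 2 (l - 1)]
   propagates from [x / l] to [x]. *)
pose K := log_integral f (l * M) / f M + 2 * (l - 1).
have Kl : 2 * (l - 1) <= K by rewrite lerDr divr_ge0// ltW.
have K0 : 0 < K by apply: lt_le_trans Kl; lra.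
(* On the first interval the integral is at most its value at [l * M], and [f x] is at least [f M];
   the first term of [K] is the ratio of these two. *)
have base x : M <= x -> x <= l * M -> log_integral f x <= K * f x.
  move=> Mx xM.
  have /andP[+ _] := bnd x (l * M) (le_trans M1 Mx) xM.
  have I0 : 0 <= (l * M - x) / (l * M) * f x.
    by rewrite mulr_ge0// divr_ge0 ?subr_ge0// mulr_ge0 ?ltW.
  move=> /(le_trans I0); rewrite subr_ge0 => /le_trans; apply.
  rewrite -[log_integral f (l * M)](divfK (lt0r_neq0 fM0)).
  by apply: ler_pM; rewrite ?divr_ge0 ?f_ndecr ?(ltW fM0)// /K lerDl; lra.
have I_le n (x : R) : M <= x -> x <= l ^+ n * M -> log_integral f x <= K * f x.
  elim: n x => [|n IH] x Mx xM.
    by apply: base => //; apply: le_trans xM _; rewrite expr0 mul1r ler_peMl ?ltW.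
  have [xlM|/ltW lMx] := lerP x (l * M); first exact: base.
  pose y := x / l; have xE : x = l * y by rewrite /y mulrC divfK// gt_eqF.
  have My : M <= y by rewrite /y ler_pdivlMr// mulrC.
  have y0 : 0 < y by exact: lt_le_trans My.
  have yx : y <= x by rewrite xE ler_peMl ?ltW.
  have yM : y <= l ^+ n * M by rewrite /y ler_pdivrMr// mulrC mulrA -exprS.
  have := IH y My yM; have [_] := H y My; rewrite -xE.
  have /andP[_] := bnd y x (le_trans M1 My) yx.
  have -> : (x - y) / y = l - 1 by rewrite xE; field; rewrite gt_eqF.
  by have := f_ge0 x; have := f_ge0 y; nra.
exists (2 * C + K); first by rewrite addr_gt0// mulr_gt0.
have {}fC : \forall x \near +oo, f x <= C * f (x / 2).
  have half0 : 0 < 2^-1 :> R by rewrite invr_gt0.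
  have {}fC := near_pinftyM half0 fC; near=> x.
  have -> : x / 2 = 2^-1 * x by rewrite mulrC.
  have {1}-> : x = 2 * (2^-1 * x) by field.
  by near: x.
near=> x; split.
  apply: (@le_trans _ _ (K * f x)); last by rewrite ler_wpM2r// lerDr mulr_ge0// ltW.
  have Mx : M <= x by near: x; exact: (nbhs_pinfty_ge (num_real _)).
  have [n xn] := expr_ge_ex x l1; apply: (I_le n) => //.
  by apply: le_trans xn _; rewrite ler_peMr// exprn_ge0// ltW.
(* The interval from [x / 2] to [x] alone contributes at least [f (x / 2) / 2], so [f x] is at most
   [2 * C] times the integral. *)
apply: (@le_trans _ _ (C * f (x / 2))); first by near: x.
have x2 : 2 <= x by near: x; exact: (nbhs_pinfty_ge (num_real _)).
have y1 : 1 <= x / 2 by lra.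
have yx : x / 2 <= x by lra.
have /andP[+ _] := bnd _ _ y1 yx.
have -> : (x - x / 2) / x = 2^-1 by field; lra.
have := lI0 (x / 2); have := lI0 x; have := f_ge0 (x / 2); nra.
Unshelve. all: by end_near. Qed.

Lemma growth_regular : doubling f -> expanding f ->
  O_regularly_varying f /\ positive_increase f.
Proof.
move=> fd [l l1 fl]; split.
  split=> // m m0.
  have fm0 x : 0 <= f (m * x) by [].
  apply/(@eqTheta_ge0P _ (fun x => f (m * x)) f) => //.
  (* The reverse estimate is the dilation by [m^-1], taken at the point [m * x]. *)
  have [C C0 fC] := doubling_dilation m fd.
  have [D D0 fD] := doubling_dilation m^-1 fd.
  have {}fD := near_pinftyM m0 fD.
  exists (C + D); first exact: addr_gt0.
  near=> x; split.
    apply: (@le_trans _ _ (C * f x)); first by near: x.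
    by rewrite ler_wpM2r// lerDl ltW.
  apply: (@le_trans _ _ (D * f (m * x))); last by rewrite ler_wpM2r// lerDr ltW.
  rewrite -[in leLHS](mulKf (lt0r_neq0 m0) x); near: x; exact: fD.
have l0 : 0 < l by exact: lt_trans l1.
have lnl0 : 0 < ln l by rewrite ln_gt0.
(* With [l ^ c = 2], each dilation by [l] doubles both [f x] and [x ^ c]. *)
have [c c0 lc] : exists2 c, 0 < c & l `^ c = 2.
  exists (ln 2 / ln l); first by rewrite divr_gt0// ln_gt0// ltr1n.
  by rewrite /powR gt_eqF// divfK ?gt_eqF// lnK// posrE.
rewrite /positive_increase; apply: (@lt_le_trans _ _ c%:E); first by rewrite lte_fin.
apply: ereal_sup_ubound; exists c => //.
have [M M1 {fl} H] : exists2 M, 1 <= M & forall x, M <= x -> 2 * f x <= f (l * x).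
  exact: near_pinfty_ge_ex.
have M0 : 0 < M by exact: lt_le_trans M1.
exists M, 2^-1; split; first by rewrite invr_gt0.
move=> x y Mx xy; have x0 : 0 < x by exact: lt_le_trans Mx.
rewrite !powRN.
(* Climb from [z] to [y] by dilations by [l]. A complete step doubles both [f] at the lower end and
   the power, without loss; the factor 2 pays for the last incomplete one, where [y <= l * z]. *)
have key n (z : R) : M <= z -> z <= y -> y <= l ^+ n * z ->
    y `^ c * f z <= 2 * (z `^ c * f y).
  elim: n z => [|n IH] z Mz zy.
    rewrite expr0 mul1r => yz; have <- : y = z by apply/eqP; rewrite eq_le yz zy.
    by have := mulr_ge0 (powR_ge0 y c) (f_ge0 y); lra.
  have z0 : 0 < z by exact: lt_le_trans Mz.
  rewrite exprSr -mulrA => yz; have [lzy|/ltW ylz] := lerP (l * z) y.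
    have Mlz : M <= l * z by apply: le_trans Mz _; rewrite ler_peMl ?ltW.
    have := IH _ Mlz lzy yz; rewrite (powRM _ (ltW l0) (ltW z0)) lc.
    have /(ler_wpM2l (powR_ge0 y c)) := H z Mz.
    lra.
  have : y `^ c <= (l * z) `^ c.
    apply: ge0_ler_powR; rewrite ?nnegrE ?mulr_ge0 ?(ltW c0) ?(ltW l0) ?(ltW z0)//.
    exact: le_trans (ltW z0) zy.
  rewrite (powRM _ (ltW l0) (ltW z0)) lc mulrA => h.
  by rewrite ler_pM ?powR_ge0// f_ndecr.
have [n yn] := expr_ge_ex y l1.
have yn' : y <= l ^+ n * x.
  by apply: le_trans yn _; rewrite ler_peMr ?exprn_ge0 ?(ltW l0)// (le_trans M1).
have := key n x Mx xy yn'.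
have y0 : 0 < y by exact: lt_le_trans xy.
have xc : 0 < x `^ c by exact: powR_gt0.
have yc : 0 < y `^ c by exact: powR_gt0.
move=> h; rewrite [leRHS]mulrC ler_pdivlMr//.
have -> : 2^-1 * ((x `^ c)^-1 * f x) * y `^ c = y `^ c * f x / (2 * x `^ c).
  by field; rewrite gt_eqF.
by rewrite ler_pdivrMr ?mulr_gt0//; lra.
Unshelve. all: by end_near. Qed.

(** Doubling is regular variation at dilation 2. A positive supremum leaves some [c > 0] with
    [f x / x ^ c] almost increasing, so a dilation by a large [l] gains [m * l ^ c], where [m] is
    the constant of almost increase. *)
Lemma regular_growth : O_regularly_varying f -> positive_increase f ->
  doubling f /\ expanding f.
Proof.
move=> [_ /(_ 2 (ltr0n _ 2)) +] /ereal_sup_gt[_ [c [M [m [m0 H]]] <-]].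
rewrite lte_fin => /[swap] c0.
move/(@eqTheta_ge0P _ (fun x => f (2 * x)) f) => /(_ (fun=> f_ge0 _) f_ge0)[C C0 fC].
split; first by exists C => //; apply: filterS fC => x [].
(* [k] solves [m * k ^ c = 2]; adding 2 makes the dilation factor exceed 1. *)
pose k := (2 / m) `^ c^-1; exists (2 + k); first by have := powR_ge0 (2 / m) c^-1; rewrite -/k; lra.
have k0 : 0 < k by rewrite powR_gt0// divr_gt0.
near=> x; have x0 : 0 < x by near: x; exact: (nbhs_pinfty_gt (num_real _)).
have Mx : M <= x by near: x; exact: (nbhs_pinfty_ge (num_real _)).
have xy : x <= (2 + k) * x by rewrite ler_peMl ?ltW//; lra.
have k2 : 0 <= 2 + k by lra.
have := H _ _ Mx xy; rewrite !powRN (powRM _ k2 (ltW x0)).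
have xc : 0 < x `^ c by exact: powR_gt0.
have kc : 2 / m <= (2 + k) `^ c.
  have -> : 2 / m = k `^ c.
    by rewrite /k -powRrM mulVf ?gt_eqF// powRr1// ltW// divr_gt0.
  apply: ge0_ler_powR; rewrite ?nnegrE ?(ltW c0) ?(ltW k0)//; lra.
have yc : 0 < (2 + k) `^ c by apply: powR_gt0; lra.
rewrite invfM -mulrA ler_pdivlMl// => h.
have : (2 + k) `^ c * m * f x <= f ((2 + k) * x).
  rewrite -(ler_pM2l (_ : 0 < (x `^ c)^-1)) ?invr_gt0//; apply: le_trans h.
  by rewrite le_eqVlt; apply/orP; left; apply/eqP; ring.
apply: le_trans; rewrite ler_wpM2r//.
by rewrite -ler_pdivrMr.
Unshelve. all: by end_near. Qed.

End dilations.

(** * Transfer of the dilation inequalities through [f (x / h) ^ h <= g x <= f x ^ h] *)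

Lemma growth_expr {R : realType} (f g : R -> R) (h : nat) : (0 < h)%N ->
  (forall x, 0 <= f x) -> (forall x, f x ^+ h <= g (h%:R * x)) ->
  (forall x, g x <= f x ^+ h) -> {homo f : x y / x <= y} ->
  doubling f -> expanding f -> doubling g /\ expanding g.
Proof.
move=> h0 f_ge0 f_le_g g_le_f f_ndecr fd [l l1 fl].
have hR0 : 0 < h%:R :> R by rewrite ltr0n.
split.
  (* The sandwich bounds [g x] below only by [f] at [x / h], so [f] has to be controlled from
     [x / h] up to [2 * x]. *)
  have [C C0 fC] := doubling_dilation f_ndecr (2 * h%:R) fd.
  exists (C ^+ h); first exact: exprn_gt0.
  have hV0 : 0 < h%:R^-1 :> R by rewrite invr_gt0.
  have {}fC := near_pinftyM hV0 fC; near=> x.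
  apply: le_trans (g_le_f _) _.
  have -> : g x = g (h%:R * (h%:R^-1 * x)) by rewrite mulVKf// gt_eqF.
  apply: (@le_trans _ _ ((C * f (h%:R^-1 * x)) ^+ h)).
    rewrite lerXn2r ?nnegrE ?mulr_ge0 ?(ltW C0)//.
    have -> : 2 * x = 2 * h%:R * (h%:R^-1 * x) by rewrite -mulrA mulVKf// gt_eqF.
    by near: x.
  by rewrite exprMn ler_wpM2l ?exprn_ge0 ?(ltW C0).
have h1 : 1 <= h%:R :> R by rewrite ler1n.
(* At this dilation [g] is at least [f (l * x) ^ h >= 2 ^ h * f x ^ h], which is at least
   [2 * g x]. *)
exists (h%:R * l); first by nra.
near=> x; rewrite -mulrA; apply: le_trans (f_le_g _).
apply: (@le_trans _ _ ((2 * f x) ^+ h)); last first.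
  by rewrite lerXn2r ?nnegrE ?mulr_ge0//; near: x.
rewrite exprMn; apply: (@le_trans _ _ (2 * f x ^+ h)); first by rewrite ler_pM2l.
rewrite ler_wpM2r ?exprn_ge0//.
by rewrite -[leLHS]expr1 ler_weXn2l// ler1n.
Unshelve. all: by end_near. Qed.

(** Both inequalities for [f] are proved between [h]-th powers, which the sandwich compares with
    values of [g]. *)
Lemma growth_root {R : realType} (f g : R -> R) (h : nat) : (0 < h)%N ->
  (forall x, 0 <= f x) -> (forall x, f x ^+ h <= g (h%:R * x)) ->
  (forall x, g x <= f x ^+ h) -> (forall x, 0 <= g x) ->
  {homo g : x y / x <= y} ->
  doubling g -> expanding g -> doubling f /\ expanding f.
Proof.
move=> h0 f_ge0 f_le_g g_le_f g_ge0 g_ndecr gd ge.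
have hR0 : 0 < h%:R :> R by rewrite ltr0n.
split.
  have [C C0 gC] := doubling_dilation g_ndecr (h%:R * 2) gd.
  (* The constant [C + 1] avoids an [h]-th root of [C]: being at least 1, it satisfies
     [C <= (C + 1) ^ h]. *)
  exists (C + 1); first by rewrite addr_gt0.
  near=> x.
  rewrite -(@ler_pXn2r _ h)// ?nnegrE ?mulr_ge0 ?addr_ge0 ?(ltW C0)//.
  apply: le_trans (f_le_g _) _; rewrite mulrA.
  apply: (@le_trans _ _ (C * g x)); first by near: x.
  rewrite exprMn; apply: ler_pM; rewrite ?(ltW C0)//.
  apply: (@le_trans _ _ (C + 1)); first by rewrite lerDl.
  by rewrite -[leLHS]expr1 ler_weXn2l// lerDr ltW.
(* A gain of [2 ^ h] for [g] is what leaves a gain of 2 for [f] after the [h]-th root. *)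
have [l l1 gl] := expanding_iter g_ndecr h ge.
have h1 : 1 <= h%:R :> R by rewrite ler1n.
exists (l * h%:R); first by nra.
have {}gl := near_pinftyM hR0 gl; near=> x.
rewrite -(@ler_pXn2r _ h)// ?nnegrE ?mulr_ge0//.
apply: le_trans (g_le_f _); rewrite -mulrA exprMn.
apply: (@le_trans _ _ (2 ^+ h * g (h%:R * x))); last by near: x.
by rewrite ler_wpM2l ?exprn_ge0.
Unshelve. all: by end_near. Qed.

(** * Counting functions and representation sums *)

Section counting.
Context {R : realType}.
Variable A : set nat.
Implicit Type x : R.

Local Notation upto x := [set k : nat | A k /\ k%:R <= x].
Local Notation cA := (@counting_function R A).

Lemma finite_upto x : finite_set (upto x).
Proof.
apply: sub_finite_set (finite_II (Num.trunc x).+1) => k /= [_ kx].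
by rewrite -(ltr_nat R); apply: le_lt_trans kx (truncnS_gt x).
Qed.

Lemma counting_function_ge0 x : 0 <= cA x. Proof. by []. Qed.

Lemma counting_function_ndecr : {homo cA : x y / x <= y}.
Proof.
move=> x y xy; rewrite ler_nat; apply: fsubset_leq_card.
rewrite -fset_set_sub; [|exact: finite_upto|exact: finite_upto].
by move=> k /= [Ak kx]; split=> //; exact: le_trans xy.
Qed.

(** The cube is the injective image of the finite type of [h]-tuples over [X], which yields
    finiteness and cardinality together. *)
Lemma fset_set_tuple (h : nat) (X : {fset nat}) :
  let cube := [set k : h.-tuple nat | forall i, tnth k i \in X] in
  finite_set cube /\ #|` fset_set cube| = (#|` X| ^ h)%N.
Proof.
set cube := [set _ | _].
have cubeE : cube = [set` [fset map_tuple val t | t in {: h.-tuple X}]%fset].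
  apply/seteqP; split=> k /=.
    move=> kX; apply/imfsetP => /=; exists [tuple FSetSub (kX i) | i < h] => //.
    by apply: eq_from_tnth => i; rewrite tnth_map tnth_mktuple.
  by move=> /imfsetP[t _ ->] i; rewrite tnth_map fsvalP.
split; first by rewrite cubeE.
rewrite cubeE set_fsetK card_imfset/=.
  by rewrite -cardT card_tuple -cardfE.
move=> s t /(congr1 val) /= /(inj_map val_inj) st; exact: val_inj.
Qed.

Lemma finite_tuple_sum_le (h : nat) x : finite_set
  [set k : h.-tuple nat |
     (forall i, A (tnth k i)) /\ (\sum_(i < h) tnth k i)%N%:R <= x].
Proof.
have [+ _] := fset_set_tuple h (fset_set (upto x)).
apply: sub_finite_set => k /= [kA kx] i.
rewrite in_fset_set; last exact: finite_upto.
rewrite inE /=; split=> //; apply: le_trans kx.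
by rewrite ler_nat (bigD1 i)//= leq_addr.
Qed.

Lemma representation_sum_ge0 h x : 0 <= representation_sum A h x.
Proof. by []. Qed.

Lemma representation_sum_ndecr h :
  {homo (@representation_sum R A h) : x y / x <= y}.
Proof.
move=> x y xy; rewrite ler_nat; apply: fsubset_leq_card.
rewrite -fset_set_sub; [|exact: finite_tuple_sum_le|exact: finite_tuple_sum_le].
by move=> k /= [Ak kx]; split=> //; exact: le_trans xy.
Qed.

(** Each entry is at most the sum, so the tuples counted lie in the cube over the elements up to
    [x]. *)
Lemma representation_sum_le h x : representation_sum A h x <= cA x ^+ h.
Proof.
rewrite -natrX ler_nat.
have [cf <-] := fset_set_tuple h (fset_set (upto x)).
apply: fsubset_leq_card; rewrite -fset_set_sub//; last exact: finite_tuple_sum_le.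
move=> k /= [kA kx] i.
rewrite in_fset_set; last exact: finite_upto.
rewrite inE /=; split=> //; apply: le_trans kx.
by rewrite ler_nat (bigD1 i)//= leq_addr.
Qed.

(** Conversely, [h] entries that are at most [x] have sum at most [h * x]. *)
Lemma representation_sum_ge h x : cA x ^+ h <= representation_sum A h (h%:R * x).
Proof.
rewrite -natrX ler_nat.
have [cf <-] := fset_set_tuple h (fset_set (upto x)).
apply: fsubset_leq_card; rewrite -fset_set_sub//; last exact: finite_tuple_sum_le.
move=> k /= kx.
have {}kx i : A (tnth k i) /\ (tnth k i)%:R <= x.
  have := kx i; rewrite in_fset_set; last exact: finite_upto.
  by rewrite inE.
split=> [i|]; first by case: (kx i).
rewrite natr_sum; apply: (@le_trans _ _ (\sum_(i < h) x)).
  by apply: ler_sum => i _; case: (kx i).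
by rewrite sumr_const card_ord mulr_natl.
Qed.

(** * The counting function and the increasing enumeration *)

Variable a : nat -> nat.
Hypothesis a_enum : is_increasing_enumeration A a.

Lemma leq_enumeration : {mono a : m n / (m <= n)%N}.
Proof. by case: a_enum => a_incr _; exact: leq_mono. Qed.

Lemma ge_enumeration n : (n <= a n)%N.
Proof.
by elim: n => // n IH; apply: leq_ltn_trans IH _; case: a_enum => + _; apply.
Qed.

(** If [a n <= x], the [n + 1] elements from [a 0] to [a n] are counted; otherwise only elements of
    index below [n] can be. *)
Lemma lt_counting_function n x : (n%:R < cA x) = ((a n)%:R <= x).
Proof.
have [a_incr aA] := a_enum.
have card_aI m : #|` fset_set (a @` `I_m)| = m.
  rewrite fset_set_image ?fset_set_II; last exact: finite_II.
  rewrite card_imfset; last by move=> i j /eqP; rewrite eqn_leq !leq_enumeration -eqn_leq => /eqP.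
  by rewrite card_imfset ?size_enum_ord //; exact: val_inj.
rewrite ltr_nat; have [anx|xan] := lerP (a n)%:R x.
  rewrite -[X in (X <= _)%N](card_aI n.+1); apply: fsubset_leq_card.
  rewrite -fset_set_sub; [|exact/finite_image/finite_II|exact: finite_upto].
  move=> _ [i /= ilen <-]; split; first by rewrite -aA; exists i.
  by apply: le_trans anx; rewrite ler_nat leq_enumeration.
apply/negbTE; rewrite -leqNgt -[X in (_ <= X)%N](card_aI n).
apply: fsubset_leq_card.
rewrite -fset_set_sub; [|exact: finite_upto|exact/finite_image/finite_II].
move=> k /=; rewrite -aA => -[[i _ <-] aix]; exists i => //=.
by rewrite ltnNge -leq_enumeration -ltnNge -(ltr_nat R); exact: le_lt_trans xan.
Qed.

Lemma counting_function_gt0 : \forall x \near +oo, 0 < cA x.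
Proof.
near=> x; rewrite (lt_counting_function 0).
by near: x; exact: (nbhs_pinfty_ge (num_real _)).
Unshelve. all: by end_near. Qed.

Lemma representation_sum_gt0 h : (0 < h)%N ->
  \forall x \near +oo, 0 < @representation_sum R A h x.
Proof.
move=> h0; have hV0 : 0 < h%:R^-1 :> R by rewrite invr_gt0 ltr0n.
have cA0 := near_pinftyM hV0 counting_function_gt0; near=> x.
have <- : h%:R * (h%:R^-1 * x) = x by rewrite mulVKf// gt_eqF// ltr0n.
apply: lt_le_trans (representation_sum_ge _ _); apply: exprn_gt0.
by near: x.
Unshelve. all: by end_near. Qed.

Lemma expanding_counting_function : expanding cA <->
  ((fun n : nat => (a (2 * n)%N)%:R) : nat -> R^o) =O_\oo
    ((fun n : nat => (a n)%:R) : nat -> R^o).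
Proof.
rewrite eqO_ge0P//; split=> [[l l1 H]|[C C0 [N _ H]]].
  (* At [x = a n] one has [n < cA x], so expansion gives [2 * n < cA (l * a n)], that is
     [a (2 * n) <= l * a n]. *)
  exists l; first exact: lt_trans l1.
  have [M M1 {}H] := near_pinfty_ge_ex 1 H.
  exists (Num.trunc M).+1 => // n /= Mn.
  have Man : M <= (a n)%:R.
    apply: le_trans (ltW (truncnS_gt M)) _; rewrite ler_nat.
    exact: leq_trans Mn (ge_enumeration n).
  rewrite -lt_counting_function; apply: lt_le_trans (H _ Man).
  by rewrite natrM ltr_pM2l// lt_counting_function.
(* With [m = cA x - 1], the last index such that [a m <= x], the goal becomes
   [a (2 * m + 1) <= (C ^+ 2 + 1) * x]. Since [2 * m + 1 <= 4 * m], two uses of the hypothesis give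
   [C ^+ 2]; the added 1 makes the factor exceed 1. *)
exists (C ^+ 2 + 1); first by rewrite ltrDr exprn_gt0.
(* Beyond this threshold [m > N], so [m] is positive and the hypothesis applies at [m] and at
   [2 * m]. *)
exists (a N.+1)%:R; split; first exact: num_real.
move=> x /ltW aNx.
have : N.+1%:R < cA x by rewrite lt_counting_function.
rewrite {1 2}/counting_function; set c := #|` _| => Nc.
have cE : c = c.-1.+1 by move: Nc; rewrite ltr_nat; case: (c).
set m := c.-1 in cE.
have Nm : (N < m)%N by move: Nc; rewrite ltr_nat cE.
have amx : (a m)%:R <= x.
  by rewrite -lt_counting_function /counting_function -/c ltr_nat cE.
have : (a (2 * m).+1)%:R <= (C ^+ 2 + 1) * x.
  apply: (@le_trans _ _ (a (2 * (2 * m)))%:R).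
    by rewrite ler_nat leq_enumeration; lia.
  apply: le_trans (H (2 * m)%N _) _; first by rewrite /=; lia.
  have am0 : 0 <= (a m)%:R :> R by [].
  have h2 : (a (2 * m)%N)%:R <= C * (a m)%:R by apply: H; rewrite /= ltnW.
  rewrite expr2; nra.
rewrite -lt_counting_function /counting_function ltr_nat => m_lt.
by rewrite -/c -natrM ler_nat cE mulnS.
Qed.

Lemma growth_counting_function_representation_sum h : (0 < h)%N ->
  (doubling cA /\ expanding cA) <->
  (doubling (representation_sum A h : R -> R) /\
   expanding (representation_sum A h : R -> R)).
Proof.
move=> h0; split=> -[].
  apply: growth_expr; [exact: h0|exact: counting_function_ge0|
    exact: representation_sum_ge|exact: representation_sum_le|
    exact: counting_function_ndecr].
apply: growth_root; [exact: h0|exact: counting_function_ge0|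
  exact: representation_sum_ge|exact: representation_sum_le|
  exact: representation_sum_ge0|exact: representation_sum_ndecr].
Qed.

End counting.

Theorem propositionA8 (R : realType) (A : set nat) (a : nat -> nat)
    (A_infinite : infinite_set A)
    (a_enum : is_increasing_enumeration A a) :
  let cA : R -> R^o := counting_function A in
  let s (h : nat) : R -> R^o := representation_sum A h in
  [<->
    (* (i) *)
    O_regularly_varying cA /\ positive_increase cA;
    (* (ii) *)
    (log_integral cA : R -> R^o) =Theta_+oo cA;
    (* (iii) *)
    ((fun x => cA (2 * x)) : R -> R^o) =O_+oo cA /\
    ((fun n : nat => (a (2 * n)%N)%:R) : nat -> R^o) =O_\oo
      ((fun n : nat => (a n)%:R) : nat -> R^o);
    (* (iv), for all h *)
    forall h : nat, (1 <= h)%N ->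
      (log_integral (s h) : R -> R^o) =Theta_+oo s h;
    (* (iv), for at least one h *)
    exists h : nat, (1 <= h)%N /\
      (log_integral (s h) : R -> R^o) =Theta_+oo s h ].
Proof.
move=> cA s.
have cA0 x : 0 <= cA x by exact: counting_function_ge0.
have cAle : {homo cA : x y / x <= y} by exact: counting_function_ndecr.
have cA1 := counting_function_gt0 a_enum : \forall x \near +oo, 0 < cA x.
have s0 h x : 0 <= s h x by exact: representation_sum_ge0.
have sle h : {homo s h : x y / x <= y} by exact: representation_sum_ndecr.
have doublingP : doubling cA <->
    ((fun x => cA (2 * x)) : R -> R^o) =O_+oo (cA : R -> R^o).
  by rewrite eqO_ge0P.
tfae.
- move=> [reg inc]; have [] := regular_growth cA0 reg inc.
  exact: growth_log_integral_Theta.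
- move=> /(log_integral_Theta_growth cA0 cAle)[/doublingP dbl exp].
  by split=> //; exact/(expanding_counting_function a_enum).
- move=> [/doublingP dbl /(expanding_counting_function a_enum) exp] h h1.
  have [sd se] := (growth_counting_function_representation_sum A h1).1 (conj dbl exp).
  apply: growth_log_integral_Theta => //.
  exact: (representation_sum_gt0 a_enum).
- by move=> H; exists 1%N; split => //; exact: H.
(* The growth of a single [s h] already determines that of [cA], which closes the cycle of
   implications. *)
- move=> [h [h1 /(log_integral_Theta_growth (s0 h) (sle h))]].
  move=> /(growth_counting_function_representation_sum A h1)[].
  exact: growth_regular.
Qed.
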